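(* Let $p$ be a prime and $\mathcal{U}=\mathrm{PSL}(2,\mathcal{O}_p)$. If $G$ is a subgroup of $\mathrm{PSL}(2,\mathbb{C}_p)$ with $G\cap\mathcal{U}=\{I\}$, then $G$ is a discrete subgroup.
   Context: $\mathbb{C}_p$ is the completion of the algebraic closure of $\mathbb{Q}_p$; $\mathcal{O}_p=\{z\in\mathbb{C}_p:|z|\le1\}$. $\mathrm{PSL}(2,\mathbb{C}_p)=\mathrm{SL}(2,\mathbb{C}_p)/\{\pm I\}$, and $\mathrm{PSL}(2,\mathcal{O}_p)$ is the subgroup of those elements whose lifts to $\mathrm{SL}(2,\mathbb{C}_p)$ have all entries in $\mathcal{O}_p$. For a matrix, $\|(a_{ij})\|=\max_{i,j}|a_{ij}|$. For $g,h\in\mathrm{PSL}(2,\mathbb{C}_p)$ with lifts $g_1,g_2$ and $h_1,h_2$ in $\mathrm{SL}(2,\mathbb{C}_p)$, $\|g-h\|=\inf_{1\le i\le2,\,1\le j\le2}\|g_i-h_j\|$. A subgroup $G$ of $\mathrm{PSL}(2,\mathbb{C}_p)$ is called discrete if there exists $\varepsilon>0$ such that $\|g-I\|>\varepsilon$ for every non-identity element $g\in G$. *)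

(* Defs.v *)
From HB Require Import structures.
From mathcomp Require Import all_boot all_order all_algebra.
From mathcomp Require Import generic_quotient.
From mathcomp Require Import boolp classical_sets reals topology normedtype.

Set Implicit Arguments.
Unset Strict Implicit.
Unset Printing Implicit Defensive.

Import Order.TTheory GRing.Theory Num.Theory.
Import numFieldNormedType.Exports.

Local Open Scope classical_set_scope.
Local Open Scope ring_scope.
Local Open Scope quotient_scope.

Section AbsoluteValues.
Variable R : realType.

Record is_absolute_value (K : fieldType) (v : K -> R) : Prop := IsAbsoluteValue {
  absv_ge0 : forall x, 0 <= v x;
  absv_eq0 : forall x, v x = 0 <-> x = 0;
  absvM : forall x y, v (x * y) = v x * v y;
  absvD : forall x y, v (x + y) <= v x + v y
}.

Definition is_complete (K : fieldType) (v : K -> R) : Prop :=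
  forall u : nat -> K,
    (forall e : R, 0 < e -> \forall m & n \near \oo, v (u m - u n) < e) ->
    exists l : K, v (u n - l) @[n --> \oo] --> (0 : R).

Record is_completion (K : fieldType) (vK : K -> R) (L : fieldType) (vL : L -> R)
    (f : {rmorphism K -> L}) : Prop := IsCompletion {
  completion_absv : is_absolute_value vL;
  completion_isometric : forall x, vL (f x) = vK x;
  completion_dense : forall (y : L) (e : R), 0 < e -> exists x, vL (y - f x) < e;
  completion_complete : is_complete vL
}.

Definition is_algebraic_closure (F E : fieldType) (f : {rmorphism F -> E}) : Prop :=
  (forall x : E, algebraicOver f x) /\ GRing.closed_field_axiom E.

(* |a / b|_p = p ^ (v_p(b) - v_p(a)) *)
Definition padic_absv (p : nat) (x : rat) : R :=
  if x == 0 then 0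
  else p%:R ^ ((logn p `|denq x|%N)%:Z - (logn p `|numq x|%N)%:Z).

(* The p-adic fields Q_p and C_p are not in the library; since each step of the
   construction is unique up to isometric isomorphism, C_p is specified by the
   tower Q -> Q_p -> Qbar_p -> C_p: complete Q for |.|_p, take an algebraic
   closure with an absolute value extending that of Q_p, and complete again. *)
Definition is_Cp (p : nat) (Cp : fieldType) (vC : Cp -> R) : Prop :=
  exists (Qp : fieldType) (vQ : Qp -> R) (i : {rmorphism rat -> Qp})
         (Qpbar : fieldType) (vA : Qpbar -> R) (j : {rmorphism Qp -> Qpbar})
         (k : {rmorphism Qpbar -> Cp}),
    [/\ is_completion (padic_absv p) vQ i,
        is_algebraic_closure j,
        is_absolute_value vA,
        forall x, vA (j x) = vQ x
      & is_completion vA vC k].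

End AbsoluteValues.

Section SL2.
Variable K : fieldType.

Definition SL2 := {A : 'M[K]_2 | \det A == 1}.

HB.instance Definition _ := Choice.on SL2.

Fact SL2_one_subproof : \det (1%:M : 'M[K]_2) == 1.
Proof. by rewrite det1. Qed.

Fact SL2_mul_subproof (A B : SL2) : \det (val A *m val B) == 1.
Proof. by rewrite det_mulmx (eqP (valP A)) (eqP (valP B)) mulr1. Qed.

Fact SL2_inv_subproof (A : SL2) : \det (invmx (val A)) == 1.
Proof. by rewrite det_inv (eqP (valP A)) invr1. Qed.

Fact SL2_opp_subproof (A : SL2) : \det (- val A) == 1.
Proof. by rewrite -scaleN1r detZ sqrrN expr1n mul1r (valP A). Qed.

Definition SL2_one : SL2 := Sub 1%:M SL2_one_subproof.
Definition SL2_mul (A B : SL2) : SL2 := Sub (val A *m val B) (SL2_mul_subproof A B).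
Definition SL2_inv (A : SL2) : SL2 := Sub (invmx (val A)) (SL2_inv_subproof A).
Definition SL2_opp (A : SL2) : SL2 := Sub (- val A) (SL2_opp_subproof A).

Fact SL2_unit (A : SL2) : val A \in unitmx.
Proof. by rewrite unitmxE (eqP (valP A)) unitr1. Qed.

Fact SL2_mulA : associative SL2_mul.
Proof. by move=> A B C; apply: val_inj; rewrite /= mulmxA. Qed.

Fact SL2_mul1 : left_id SL2_one SL2_mul.
Proof. by move=> A; apply: val_inj; rewrite /= mul1mx. Qed.

Fact SL2_mulr1 : right_id SL2_one SL2_mul.
Proof. by move=> A; apply: val_inj; rewrite /= mulmx1. Qed.

Fact SL2_mulV : left_inverse SL2_one SL2_inv SL2_mul.
Proof. by move=> A; apply: val_inj; rewrite /= mulVmx ?SL2_unit. Qed.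

Fact SL2_mulrV : right_inverse SL2_one SL2_inv SL2_mul.
Proof. by move=> A; apply: val_inj; rewrite /= mulmxV ?SL2_unit. Qed.

HB.instance Definition _ :=
  isGroup.Build SL2 SL2_mulA SL2_mul1 SL2_mulr1 SL2_mulV SL2_mulrV.

(* A and B lie in the same coset of {I, -I}. *)
Definition SL2_pm (A B : SL2) : bool := (A == B) || (A == SL2_opp B).

Fact SL2_oppK : involutive SL2_opp.
Proof. by move=> A; apply: val_inj; rewrite /= opprK. Qed.

Fact SL2_pm_refl : reflexive SL2_pm.
Proof. by move=> A; rewrite /SL2_pm eqxx. Qed.

Fact SL2_pm_sym : symmetric SL2_pm.
Proof.
move=> A B; rewrite /SL2_pm eq_sym; congr (_ || _).
by apply/eqP/eqP => ->; rewrite SL2_oppK.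
Qed.

Fact SL2_pm_trans : transitive SL2_pm.
Proof.
move=> B A C; rewrite /SL2_pm => /orP[] /eqP-> /orP[] /eqP->;
  by rewrite ?SL2_oppK eqxx ?orbT.
Qed.

Canonical SL2_pm_equiv := EquivRel SL2_pm SL2_pm_refl SL2_pm_sym SL2_pm_trans.

Definition PSL2 := {eq_quot SL2_pm}.

HB.instance Definition _ := Choice.on PSL2.
HB.instance Definition _ := EqQuotient.on PSL2.

Definition PSL2_pi (A : SL2) : PSL2 := \pi_PSL2 A.

Definition PSL2_one : PSL2 := PSL2_pi 1%g.
Definition PSL2_mul (g h : PSL2) : PSL2 := PSL2_pi (repr g * repr h)%g.
Definition PSL2_inv (g : PSL2) : PSL2 := PSL2_pi (repr g)^-1%g.

Fact PSL2_piP (A B : SL2) : reflect (A = B \/ A = SL2_opp B) (PSL2_pi A == PSL2_pi B).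
Proof.
rewrite /PSL2_pi eqmodE /= /SL2_pm.
by apply: (iffP orP) => -[] => [/eqP|/eqP|->|->]; rewrite ?eqxx; auto.
Qed.

Fact PSL2_piK (g : PSL2) : PSL2_pi (repr g) = g.
Proof. exact: reprK. Qed.

Fact PSL2_repr (A : SL2) : repr (PSL2_pi A) = A \/ repr (PSL2_pi A) = SL2_opp A.
Proof. by apply/PSL2_piP; rewrite PSL2_piK. Qed.

Fact PSL2_piM (A B : SL2) : PSL2_pi (A * B)%g = PSL2_mul (PSL2_pi A) (PSL2_pi B).
Proof.
apply/eqP/PSL2_piP.
case: (PSL2_repr A) => ->; case: (PSL2_repr B) => ->; [left|right|right|left];
  by apply: val_inj; rewrite /= ?mulNmx ?mulmxN ?opprK.
Qed.

Fact PSL2_piV (A : SL2) : PSL2_pi A^-1%g = PSL2_inv (PSL2_pi A).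
Proof.
apply/eqP/PSL2_piP; case: (PSL2_repr A) => ->; [by left | right].
suff -> : (SL2_opp A)^-1%g = SL2_opp A^-1%g by rewrite SL2_oppK.
apply: (@mulgI _ (SL2_opp A)); rewrite mulgV; apply: val_inj.
by rewrite /= mulNmx mulmxN opprK mulmxV ?SL2_unit.
Qed.

Fact PSL2_mulA : associative PSL2_mul.
Proof.
move=> g h k; rewrite -(PSL2_piK g) -(PSL2_piK h) -(PSL2_piK k).
by rewrite -!PSL2_piM mulgA.
Qed.

Fact PSL2_mul1 : left_id PSL2_one PSL2_mul.
Proof. by move=> g; rewrite -(PSL2_piK g) -PSL2_piM mul1g. Qed.

Fact PSL2_mulr1 : right_id PSL2_one PSL2_mul.
Proof. by move=> g; rewrite -(PSL2_piK g) -PSL2_piM mulg1. Qed.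

Fact PSL2_mulV : left_inverse PSL2_one PSL2_inv PSL2_mul.
Proof. by move=> g; rewrite -(PSL2_piK g) -PSL2_piV -PSL2_piM mulVg. Qed.

Fact PSL2_mulrV : right_inverse PSL2_one PSL2_inv PSL2_mul.
Proof. by move=> g; rewrite -(PSL2_piK g) -PSL2_piV -PSL2_piM mulgV. Qed.

HB.instance Definition _ :=
  isGroup.Build PSL2 PSL2_mulA PSL2_mul1 PSL2_mulr1 PSL2_mulV PSL2_mulrV.

Definition lifts (g : PSL2) : set SL2 := [set A | PSL2_pi A = g].

End SL2.

Section Discrete.
Variables (R : realType) (K : fieldType) (v : K -> R).

Definition mxnorm (A : 'M[K]_2) : R :=
  \big[Num.max/0]_(i < 2) \big[Num.max/0]_(j < 2) v (A i j).

(* The infimum runs over the at most four pairs of lifts. *)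
Definition PSL2_dist (g h : PSL2 K) : R :=
  inf [set mxnorm (val A - val B) | A in lifts g & B in lifts h].

Definition integers : set K := [set z | v z <= 1].

Definition PSL2_integers : set (PSL2 K) :=
  [set g | forall A, lifts g A -> forall i j, integers (val A i j)].

Definition is_discrete (G : set (PSL2 K)) : Prop :=
  exists2 e : R, 0 < e & forall g, G g -> g <> 1%g -> PSL2_dist g 1%g > e.

End Discrete.

(* Main.v *)
Require Import Defs.
From mathcomp Require Import all_boot all_order all_algebra.
From mathcomp Require Import boolp classical_sets reals.
From mathcomp Require Import ring lra.

(** The open unit ball around the identity of PSL(2, C_p) lies inside
    PSL(2, O_p): if a lift [A] of [g] is at distance less than 1 from [I] or
    [-I], then each entry of [A] is the sum of an element of absolute value less
    than 1 and one of absolute value at most 1 (namely 0, 1 or -1), hence lies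
    in O_p by the ultrametric inequality ([PSL2_integers_of_dist_lt1]).  A
    subgroup meeting PSL(2, O_p) trivially therefore has no nontrivial element
    at distance less than 1 from the identity.

    That the absolute value of C_p is ultrametric is seen on the natural numbers:
    it is at most 1 there, because it extends the p-adic absolute value of the
    rationals ([Cp_natr_le1]), and any absolute value with this property is
    ultrametric ([absv_ultrametric]). *)

Local Open Scope classical_set_scope.
Local Open Scope ring_scope.

Import Order.TTheory GRing.Theory Num.Theory.

Section AbsoluteValueTheory.
Context {R : realType} {K : fieldType} {v : K -> R}.
Hypothesis hv : is_absolute_value v.

Lemma absv0 : v 0 = 0.
Proof. exact/(absv_eq0 hv). Qed.

Lemma absv1 : v 1 = 1.
Proof.
have v1_neq0 : v 1 != 0.
  by apply/eqP => /(absv_eq0 hv) /eqP; rewrite oner_eq0.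
by apply: (mulfI v1_neq0); rewrite -(absvM hv) !mulr1.
Qed.

Lemma absvN x : v (- x) = v x.
Proof.
suff vN1 : v (-1) = 1 by rewrite -mulN1r (absvM hv) vN1 mul1r.
apply/eqP; rewrite -(@eqrXn2 _ 2) ?(absv_ge0 hv) //.
by rewrite expr2 -(absvM hv) mulrNN mulr1 absv1 expr1n.
Qed.

Lemma absvX x n : v (x ^+ n) = v x ^+ n.
Proof. by elim: n => [|n IHn]; rewrite ?absv1 // !exprS (absvM hv) IHn. Qed.

Lemma absv_sum n (F : 'I_n -> K) : v (\sum_(i < n) F i) <= \sum_(i < n) v (F i).
Proof.
elim/big_ind2: _ => [|x1 x2 y1 y2 le1 le2|//]; first by rewrite absv0.
by apply: le_trans (absvD hv _ _) _; apply: lerD.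
Qed.

(** Writing [r = 1 + d], Bernoulli's inequality alone only gives linear growth
    of [r ^+ m]; squaring it makes the lower bound on [r ^+ (m * 2)] quadratic
    in [m] if [d > 0], which beats the linear upper bound. *)
Lemma le1_of_exp_le_linear (r : R) : (forall n, r ^+ n <= n.+1%:R) -> r <= 1.
Proof.
move=> r_exp; rewrite leNgt; apply/negP => r_gt1.
have [d rE] : exists d, r = 1 + d by exists (r - 1); ring.
have d_gt0 : 0 < d by lra.
have bernoulli m : 1 + m%:R * d <= r ^+ m.
  elim: m => [|m IHm]; first by rewrite mul0r addr0 expr0.
  rewrite exprS; apply: le_trans (ler_wpM2l (ltW (lt_trans ltr01 r_gt1)) IHm).
  have := mulr_ge0 (ler0n R m) (sqr_ge0 d).
  by rewrite rE -natr1; nra.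
have [m] : exists m : nat, 2 / d ^+ 2 < m%:R.
  by exists (Num.bound (2 / d ^+ 2)); apply: archi_boundP;
    rewrite divr_ge0 ?sqr_ge0.
rewrite ltr_pdivrMr ?exprn_gt0 // => m_large.
have m_gt0 : 0 < m%:R :> R.
  by rewrite lt_neqAle ler0n andbT; apply/eqP => m0; move: m_large; rewrite -m0; lra.
have := r_exp (m * 2)%N; rewrite exprM -natr1 natrM.
have : (1 + m%:R * d) ^+ 2 <= (r ^+ m) ^+ 2.
  by rewrite ler_sqr ?nnegrE ?exprn_ge0 //; nra.
by nra.
Qed.

(** Every term of the binomial expansion of [(x + y) ^+ n] has value at most
    [M ^+ n], where [M] is the larger of [v x] and [v y]; hence the n-th power
    of [v (x + y) / M] is at most [n + 1] for all [n]. *)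
Lemma absv_ultrametric (v_nat : forall n, v n%:R <= 1) x y :
  v (x + y) <= Num.max (v x) (v y).
Proof.
set M := Num.max _ _.
have vx : v x <= M by rewrite le_max lexx.
have vy : v y <= M by rewrite le_max lexx orbT.
have := le_trans (absv_ge0 hv x) vx; rewrite le_eqVlt => /predU1P[M0|M_gt0].
  have v_eq0 z : v z <= M -> z = 0.
    by rewrite -M0 => z_le0; apply/(absv_eq0 hv)/le_anti; rewrite z_le0 (absv_ge0 hv).
  by rewrite (v_eq0 x vx) (v_eq0 y vy) addr0 absv0 M0.
rewrite -[M]mul1r -ler_pdivrMr //; apply: le1_of_exp_le_linear => n.
rewrite expr_div_n ler_pdivrMr ?exprn_gt0 // -absvX exprDn.
apply: le_trans (absv_sum _ _) _.
rewrite mulr_natl -[in leRHS](card_ord n.+1) -sumr_const; apply: ler_sum => i _.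
rewrite -mulr_natr !(absvM hv) !absvX.
rewrite -[leRHS]mulr1; apply: ler_pM; rewrite ?mulr_ge0 ?exprn_ge0 ?(absv_ge0 hv) //.
have -> : M ^+ n = M ^+ (n - i) * M ^+ i.
  by rewrite -[in LHS](subnK (ltnSE (ltn_ord i))) exprD.
by apply: ler_pM; rewrite ?exprn_ge0 ?lerXn2r ?nnegrE ?(absv_ge0 hv) ?(ltW M_gt0).
Qed.

End AbsoluteValueTheory.

Lemma padic_absv_natr_le1 (R : realType) p n :
  prime p -> padic_absv R p n%:R <= 1.
Proof.
move=> p_prime; rewrite /padic_absv; case: ifP => // _.
rewrite (_ : n%:R = (n : int)%:~R) // numq_int denq_int logn1 sub0r -invr_expz.
by rewrite invf_le1 ?exprn_gt0 ?exprn_ege1 ?ltr0n ?ler1n ?prime_gt0.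
Qed.

(** Each map of the tower Q -> Q_p -> Qbar_p -> C_p is isometric and fixes the
    natural numbers, so the bound is the one for the p-adic value on Q. *)
Lemma Cp_natr_le1 {R : realType} {p} {Cp : fieldType} {absp : Cp -> R} n :
  prime p -> is_Cp p absp -> absp n%:R <= 1.
Proof.
move=> p_prime [Qp [vQ [i [Qpbar [vA [j [k [hQp _ _ hj hCp]]]]]]]].
rewrite -(rmorph_nat k) (completion_isometric hCp) -(rmorph_nat j) hj.
rewrite -(rmorph_nat i) (completion_isometric hQp).
exact: padic_absv_natr_le1.
Qed.

Lemma Cp_absv {R : realType} {p} {Cp : fieldType} {absp : Cp -> R} :
  is_Cp p absp -> is_absolute_value absp.
Proof.
by move=> [Qp [vQ [i [Qpbar [vA [j [k [_ _ _ _ hCp]]]]]]]]; case: hCp.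
Qed.

Section UnitBall.
Context {R : realType} {K : fieldType} {v : K -> R}.
Hypothesis hv : is_absolute_value v.

Lemma le_mxnorm (A : 'M[K]_2) i j : v (A i j) <= mxnorm v A.
Proof.
rewrite /mxnorm; apply: le_trans (le_bigmax _ _ _).
exact: (le_bigmax _ (fun j => v (A i j)) j).
Qed.

Lemma lifts_eq (g : PSL2 K) A B : lifts g A -> lifts g B -> A = B \/ A = SL2_opp B.
Proof. by move=> <- /esym gB; apply/PSL2_piP/eqP. Qed.

Lemma PSL2_dist_lt (g h : PSL2 K) e : PSL2_dist v g h < e ->
  exists A B, [/\ lifts g A, lifts h B & mxnorm v (val A - val B) < e].
Proof.
move=> dist_lt.
have [] := inf_lt _ dist_lt.
  exists (mxnorm v (val (repr g) - val (repr h))).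
  by exists (repr g); [|exists (repr h)] => //; exact: PSL2_piK.
by move=> _ [A gA [B hB <-]] AB_lt; exists A, B.
Qed.

Lemma lifts1_integers (B : SL2 K) i j : lifts 1%g B -> v (val B i j) <= 1.
Proof.
move=> /lifts_eq /(_ (erefl : lifts 1%g (1%g : SL2 K))) B1.
have v_delta : v ((1%:M : 'M[K]_2) i j) <= 1.
  by rewrite mxE; case: (i == j); rewrite ?(absv0 hv) ?(absv1 hv).
by case: B1 => -> //=; rewrite mxE (absvN hv).
Qed.

Lemma PSL2_integers_of_dist_lt1 (v_nat : forall n, v n%:R <= 1) (g : PSL2 K) :
  PSL2_dist v g 1%g < 1 -> PSL2_integers v g.
Proof.
move=> /PSL2_dist_lt[A [B [gA B1 AB_lt1]]].
have vA i j : v (val A i j) <= 1.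
  rewrite -(subrK (val B i j) (val A i j)).
  apply: le_trans (absv_ultrametric hv v_nat _ _) _.
  rewrite ge_max lifts1_integers // andbT.
  have := le_mxnorm (val A - val B) i j; rewrite !mxE => /le_trans; apply.
  exact: ltW.
(* The only other lift of [g] is [- A], whose entries have the same values. *)
move=> C /lifts_eq /(_ gA) [] -> i j; rewrite /integers /=; first exact: vA.
by rewrite mxE (absvN hv).
Qed.

End UnitBall.

Theorem theorem1p10 (R : realType) (p : nat) (hp : prime p)
  (Cp : fieldType) (absp : Cp -> R) (hCp : is_Cp p absp)
  (G : set (PSL2 Cp)) (hG : group_closed [in G])
  (hGU : G `&` PSL2_integers absp = [set 1%g]) :
  is_discrete absp G.
Proof.
(* Any radius in the open interval ]0, 1[ works. *)
exists 2^-1; first by rewrite invr_gt0 ltr0n.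
move=> g Gg g_neq1; rewrite ltNge; apply/negP => dist_le.
apply: g_neq1; suff : [set 1%g] g by [].
rewrite -hGU; split=> //.
apply: (PSL2_integers_of_dist_lt1 (Cp_absv hCp)).
  by move=> n; exact: Cp_natr_le1 _ hp hCp.
by apply: le_lt_trans dist_le _; rewrite invf_lt1 ?ltr0n ?ltr1n.
Qed.
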